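(* Let $X^*\in\mathbb{R}^{m_1\times m_2}$ satisfy $\|X^*\|_\infty\le\gamma$ and let $r=\operatorname{rank}(X^* )$, so that $X^*\in K_{\max}(\gamma,r)$. Let $\hat X^{(2)}$ be the max-norm constrained maximum likelihood estimator $$\hat X^{(2)}\in\arg\max_{X\in K_{\max}(\gamma,r)}\ell_{\Omega,Y}(X),$$ and let $\hat\eta(\omega)=\operatorname{sign}(\hat X^{(2)}_\omega)$ be the associated plug-in classifier. Then $$\mathrm{excess}(\hat\eta,\eta^* )\le\sqrt{C_\gamma\sqrt{\frac{\operatorname{rank}(X^* )\,d}{n}}},$$ where $C_\gamma>0$ is a constant depending only on $\gamma$.
   Context: Setup (1-bit matrix completion with logistic link). Let $m_1,m_2\ge1$, $d=m_1+m_2$, and let $f(x)=e^x/(1+e^x)$. An unknown matrix $X^*\in\mathbb{R}^{m_1\times m_2}$ is given. Indices $\omega_1,\dots,\omega_n$ are i.i.d. uniform on $[m_1]\times[m_2]$ (where $[k]=\{1,\dots,k\}$), $\Omega=(\omega_i)_{i=1}^n$, and, conditionally on the indices, the labels $Y_1,\dots,Y_n\in\{-1,1\}$ are independent with $Y_i=+1$ with probability $f(X^*_{\omega_i})$ and $Y_i=-1$ with probability $1-f(X^*_{\omega_i})$. The sample is $\mathcal S=\{(Y_i,\omega_i)\}_{i=1}^n$. Log-likelihood: $\ell_{\Omega,Y}(X)=\sum_{i=1}^n\big(\mathbf 1\{Y_i=1\}\log f(X_{\omega_i})+\mathbf 1\{Y_i=-1\}\log(1-f(X_{\omega_i}))\big)$.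 Norms: $\|X\|_\infty=\max_{i,j}|X_{ij}|$; $\|U\|_{2,\infty}$ is the maximum Euclidean norm of the rows of $U$; the max-norm is $\|X\|_{\max}=\min_{X=UV^\top}\|U\|_{2,\infty}\|V\|_{2,\infty}$. For $\gamma,r>0$, $K_{\max}(\gamma,r)=\{X\in\mathbb{R}^{m_1\times m_2}:\|X\|_\infty\le\gamma,\ \|X\|_{\max}\le\gamma\sqrt r\}$. Classification risk: for a (possibly data-dependent) classifier $\eta:[m_1]\times[m_2]\to\{-1,1\}$, let $(Y,\omega)$ be a new pair independent of $\mathcal S$ with $\omega$ uniform on $[m_1]\times[m_2]$ and $Y\mid\omega$ equal to $+1$ with probability $f(X^*_\omega)$ and $-1$ otherwise; $R(\eta)=\mathbb P(Y\ne\eta(\omega)\mid\mathcal S)$. The Bayes classifier is $\eta^*(\omega)=\operatorname{sign}(X^*_\omega)$ (i.e. $+1$ iff $f(X^*_\omega)\ge1/2$, with $\operatorname{sign}(0)=+1$), which minimizes $R$. For an estimator $\hat X$ the plug-in classifier is $\hat\eta(\omega)=\operatorname{sign}(\hat X_\omega)$ and the misclassification excess risk is $\mathrm{excess}(\hat\eta,\eta^* )=\mathbb E\,R(\hat\eta)-R(\eta^* )$, the expectation being over $\mathcal S$. *)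

(* Defs.v *)
From HB Require Import structures.
From mathcomp Require Import all_boot all_order all_algebra.
From mathcomp Require Import all_classical all_reals all_analysis.
From mathcomp Require Import Rstruct.
From Stdlib Require Import Rdefinitions.

Set Implicit Arguments.
Unset Strict Implicit.
Unset Printing Implicit Defensive.
Import Order.TTheory GRing.Theory Num.Theory.
Local Open Scope ring_scope.

Notation RR := Rdefinitions.R.

Definition logistic (x : RR) : RR := expR x / (1 + expR x).

Definition supnorm (m1 m2 : nat) (X : 'M[RR]_(m1, m2)) : RR :=
  \big[Num.max/0]_(i < m1) \big[Num.max/0]_(j < m2) `|X i j|.

Definition norm2inf (m k : nat) (U : 'M[RR]_(m, k)) : RR :=
  \big[Num.max/0]_(i < m) Num.sqrt (\sum_(j < k) U i j ^+ 2).

(* max-norm: min (= inf, the min being attained) over factorizations X = U V^T *)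
Definition maxnorm (m1 m2 : nat) (X : 'M[RR]_(m1, m2)) : RR :=
  inf [set t : RR | exists (k : nat) (U : 'M[RR]_(m1, k)) (V : 'M[RR]_(m2, k)),
         X = U *m V^T /\ t = norm2inf U * norm2inf V].

Definition Kmax (m1 m2 : nat) (gamma r : RR) : set 'M[RR]_(m1, m2) :=
  [set X | supnorm X <= gamma /\ maxnorm X <= gamma * Num.sqrt r].

(* A sample S = ((Y_i, omega_i))_{i<n}; label true encodes +1, false encodes -1. *)
Definition sample (m1 m2 n : nat) := {ffun 'I_n -> bool * ('I_m1 * 'I_m2)}.

Definition loglik (m1 m2 n : nat) (S : sample m1 m2 n) (X : 'M[RR]_(m1, m2)) : RR :=
  \sum_(i < n) (if (S i).1 then ln (logistic (X (S i).2.1 (S i).2.2))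
                else ln (1 - logistic (X (S i).2.1 (S i).2.2))).

Definition sample_prob (m1 m2 n : nat) (Xs : 'M[RR]_(m1, m2)) (S : sample m1 m2 n) : RR :=
  \prod_(i < n) ((m1 * m2)%:R^-1 *
     (if (S i).1 then logistic (Xs (S i).2.1 (S i).2.2)
      else 1 - logistic (Xs (S i).2.1 (S i).2.2))).

(* classifiers [m1]x[m2] -> {-1,1}, with true encoding +1 *)
Definition classifier (m1 m2 : nat) := 'I_m1 -> 'I_m2 -> bool.

(* sign, with sign(0) = +1 *)
Definition sgn (x : RR) : bool := 0 <= x.

(* misclassification risk R(eta) = P(Y <> eta(omega)) for a fresh pair *)
Definition risk (m1 m2 : nat) (Xs : 'M[RR]_(m1, m2)) (eta : classifier m1 m2) : RR :=
  \sum_(i < m1) \sum_(j < m2) ((m1 * m2)%:R^-1 *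
     (if eta i j then 1 - logistic (Xs i j) else logistic (Xs i j))).

Definition bayes_classifier (m1 m2 : nat) (Xs : 'M[RR]_(m1, m2)) : classifier m1 m2 :=
  fun i j => sgn (Xs i j).

Definition plugin_classifier (m1 m2 : nat) (X : 'M[RR]_(m1, m2)) : classifier m1 m2 :=
  fun i j => sgn (X i j).

Definition excess (m1 m2 n : nat) (Xs : 'M[RR]_(m1, m2))
    (Xhat : sample m1 m2 n -> 'M[RR]_(m1, m2)) : RR :=
  \sum_(S : sample m1 m2 n) sample_prob Xs S * risk Xs (plugin_classifier (Xhat S))
  - risk Xs (bayes_classifier Xs).

(* Main.v *)
Require Import Defs.
From HB Require Import structures.
From mathcomp Require Import all_boot all_order all_algebra.
From mathcomp Require Import all_classical all_reals all_analysis.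
From mathcomp Require Import Rstruct.
From mathcomp Require Import perm ring lra.
Import Order.TTheory GRing.Theory Num.Theory.
Local Open Scope ring_scope.
Set Implicit Arguments.
Unset Strict Implicit.
Unset Printing Implicit Defensive.

(** The squared misclassification gap of a plug-in classifier is at most 8 times
    the relative logistic risk (an averaged Kullback-Leibler divergence). Since X*
    lies in the constraint set, optimality of the estimator bounds the expected
    relative risk by the supremum of the centred empirical process over the
    constraint set, and symmetrization and contraction reduce this to the Rademacher
    complexity of the max-norm ball. By Grothendieck's inequality (constant 8) that
    ball is dominated by the 2^(m1+m2) rank-one sign matrices, for which Massart's
    finite class bound gives sqrt ((m1+m2) n). The estimator takes finitely many
    values, so all suprema are finite maxima.

    That X* lies in the constraint set is the inequality
    maxnorm X <= sqrt (rank X) * supnorm X. Writing X = C W with C of full column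
    rank, let c be weights on the rows of C almost maximizing the determinant of
    G = C^T diag(c) C. Then every row x of C has x G^-1 x^T <= rank X + e, and
    X = (C G^-1 C^T D) (X^T D)^T with D = diag(sqrt c) is the factorization wanted. *)

(** * Grothendieck's inequality *)

Section Grothendieck.
Variable R : realType.

(** Sign vectors as nested pairs: sums over them split off one coordinate by recursion on [k]. The
    Boolean [true] stands for the sign -1. *)
Fixpoint cube (k : nat) : finType :=
  if k is k'.+1 then (bool * cube k')%type else unit.

Fixpoint rad k : ('I_k -> R) -> cube k -> R :=
  if k is k'.+1 then fun u e =>
    (-1) ^+ e.1 * u ord_max + rad (fun i => u (widen_ord (leqnSn k') i)) e.2
  else fun _ _ => 0.

Lemma sum_cubeS k (F : cube k.+1 -> R) :
  \sum_e F e = \sum_(e : cube k) (F (true, e) + F (false, e)).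
Proof.
transitivity (\sum_(b : bool) \sum_(e : cube k) F (b, e)).
  by rewrite pair_bigA /=; apply: eq_bigr => -[].
by rewrite big_bool big_split.
Qed.

Lemma sum_cube1 k : \sum_(e : cube k) 1 = 2 ^+ k :> R.
Proof.
elim: k => [|k IH]; first by rewrite sumr_const card_unit.
by rewrite sum_cubeS big_split /= IH exprS; ring.
Qed.

(** Orthogonality of the coordinate signs: the cross terms cancel between the two values of the last
    sign. Inner products thus become averages of bounded-degree sign polynomials. *)
Lemma sum_rad_mul k (u v : 'I_k -> R) :
  \sum_e rad u e * rad v e = 2 ^+ k * \sum_i u i * v i.
Proof.
elim: k u v => [|k IH] u v; first by rewrite big_ord0 mulr0 big1 // => e; rewrite mul0r.
rewrite sum_cubeS /= expr1 expr0 big_ord_recr /= mulrDr exprS -mulrA -IH mulr_sumr.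
have -> : 2 * 2 ^+ k * (u ord_max * v ord_max) =
  \sum_(e : cube k) 2 * (u ord_max * v ord_max) * 1.
  by rewrite -mulr_sumr sum_cube1; ring.
by rewrite -big_split /=; apply: eq_bigr => e _; ring.
Qed.

(** Khintchine's fourth moment bound. Adding a coordinate [x] contributes [6 x^2 s + x^4] on
    average, while [3 (s + x^2)^2] grows by [6 x^2 s + 3 x^4]. *)
Lemma sum_rad_exp4 k (u : 'I_k -> R) :
  \sum_e rad u e ^+ 4 <= 3 * 2 ^+ k * (\sum_i u i ^+ 2) ^+ 2.
Proof.
elim: k u => [|k IH] u.
  by rewrite big_ord0 expr0n /= mulr0 big1 // => e; rewrite expr0n.
rewrite sum_cubeS /= expr1 expr0 big_ord_recr /=.
set w := fun i : 'I_k => u _; set x := u ord_max; set s := \sum_(i < k) _.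
have -> : \sum_e ((-1 * x + rad w e) ^+ 4 + (1 * x + rad w e) ^+ 4) =
    2 * (\sum_e rad w e ^+ 4) + 12 * x ^+ 2 * (\sum_e rad w e * rad w e)
    + 2 * x ^+ 4 * \sum_(e : cube k) 1.
  by rewrite !mulr_sumr -!big_split /=; apply: eq_bigr => e _; ring.
rewrite sum_rad_mul sum_cube1.
have -> : \sum_i w i * w i = s by apply: eq_bigr => i _; rewrite -expr2.
have := IH w; rewrite -/s [in 2 ^+ k.+1]exprS.
set N := 2 ^+ k; set F := \sum_e rad _ _ ^+ 4 => H.
have N0 : 0 <= N by rewrite exprn_ge0.
have : 0 <= N * x ^+ 4 by rewrite mulr_ge0 // exprn_even_ge0.
lra.
Qed.

Definition clip (x : R) : R := Num.max (- 2) (Num.min x 2).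

Variant clip_spec (x : R) : R -> Prop :=
| ClipLow of x < -2 : clip_spec x (-2)
| ClipMid of -2 <= x <= 2 : clip_spec x x
| ClipHigh of 2 < x : clip_spec x 2.

Lemma clipP x : clip_spec x (clip x).
Proof.
rewrite /clip; case: (leP x 2) => h.
  by case: (leP (-2) x) => h2; constructor; rewrite ?h2.
by rewrite max_r; [constructor|lra].
Qed.

Lemma clip_abs x : `|clip x| <= 2.
Proof. by rewrite ler_norml; case: clipP => h; apply/andP; split; lra. Qed.

Lemma clip_sqr_le x : clip x ^+ 2 <= x ^+ 2.
Proof. by case: clipP => h; nra. Qed.

(** For [y >= 2] the bound [y - 2 <= y^2 / 8] is [(y - 4)^2 >= 0]. With the fourth moment constant
    3, clipped remainders have mean square at most 3/64, below 1/16. *)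
Lemma clip_dist x : (x - clip x) ^+ 2 <= x ^+ 4 / 64.
Proof.
have key (y : R) : 2 <= y -> (y - 2) ^+ 2 <= y ^+ 4 / 64.
  move=> y2; have h : y - 2 <= y ^+ 2 / 8 by have := sqr_ge0 (y - 4); lra.
  have -> : y ^+ 4 / 64 = (y ^+ 2 / 8) ^+ 2 by field.
  by rewrite lerXn2r // nnegrE; lra.
have pos : 0 <= x ^+ 4 / 64 by rewrite divr_ge0 // exprn_even_ge0.
case: clipP => h.
- have := key (- x); rewrite (_ : (- x - 2) ^+ 2 = (x - - 2) ^+ 2); last by ring.
  by rewrite (_ : (- x) ^+ 4 = x ^+ 4); [apply; lra|ring].
- by rewrite subrr expr0n.
- by apply: key; lra.
Qed.

(** * Bilinear forms on sign vectors and on unit vectors *)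

Section Form.
Variables (m1 m2 : nat) (M : 'I_m1 -> 'I_m2 -> R).

Definition bilin (x : 'I_m1 -> R) (y : 'I_m2 -> R) : R :=
  \sum_i \sum_j M i j * (x i * y j).

(* The dimension k is arbitrary, so the best such S is insensitive to replacing
   vectors by functions on a cube. *)
Definition inner_bound (S : R) : Prop :=
  forall k (u : 'I_m1 -> 'I_k -> R) (v : 'I_m2 -> 'I_k -> R),
  (forall i, \sum_l u i l ^+ 2 <= 1) -> (forall j, \sum_l v j l ^+ 2 <= 1) ->
  \sum_l bilin (u^~ l) (v^~ l) <= S.

Lemma bilinZ a b x y : bilin (fun i => a * x i) (fun j => b * y j) = a * b * bilin x y.
Proof.
rewrite /bilin mulr_sumr; apply: eq_bigr => i _; rewrite mulr_sumr.
by apply: eq_bigr => j _; ring.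
Qed.

Lemma linear_le_sign n (c x : 'I_n -> R) : (forall i, `|x i| <= 1) ->
  \sum_i x i * c i <= \sum_i (-1) ^+ (c i < 0)%R * c i.
Proof.
move=> x1; apply: ler_sum => i _; rewrite -normrEsign.
apply: le_trans (ler_norm _) _; rewrite normrM.
by rewrite ler_piMl.
Qed.

(** The form is linear in each argument, so [x] and then [y] can be replaced by the signs of their
    coefficients without decreasing it. *)
Lemma bilin_sign_bound (W : R) :
  (forall (s : 'I_m1 -> bool) (t : 'I_m2 -> bool),
     bilin (fun i => (-1) ^+ s i) (fun j => (-1) ^+ t j) <= W) ->
  forall x y, (forall i, `|x i| <= 1) -> (forall j, `|y j| <= 1) -> bilin x y <= W.
Proof.
move=> HW x y x1 y1.
pose c i := \sum_j M i j * y j; pose s i := (c i < 0)%R.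
pose d j := \sum_i M i j * (-1) ^+ s i.
have -> : bilin x y = \sum_i x i * c i.
  by apply: eq_bigr => i _; rewrite mulr_sumr; apply: eq_bigr => j _; ring.
apply: le_trans (linear_le_sign c x1) _.
have -> : \sum_i (-1) ^+ (c i < 0)%R * c i = \sum_j y j * d j.
  under eq_bigr do rewrite mulr_sumr; rewrite exchange_big; apply: eq_bigr => j _ /=.
  by rewrite mulr_sumr; apply: eq_bigr => i _; rewrite /s; ring.
apply: le_trans (linear_le_sign d y1) _.
apply: le_trans (HW s (fun j => (d j < 0)%R)).
rewrite /bilin exchange_big le_eqVlt; apply/orP; left; apply/eqP; apply: eq_bigr => j _ /=.
by rewrite mulr_sumr; apply: eq_bigr => i _; ring.
Qed.

Lemma inner_bound_scaled S (T : finType) (u : 'I_m1 -> T -> R) (v : 'I_m2 -> T -> R) (a b : R) :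
  inner_bound S -> 0 < a -> 0 < b ->
  (forall i, \sum_l u i l ^+ 2 <= a ^+ 2) -> (forall j, \sum_l v j l ^+ 2 <= b ^+ 2) ->
  \sum_l bilin (u^~ l) (v^~ l) <= S * (a * b).
Proof.
move=> HS a0 b0 ua vb.
have enumE (F : T -> R) : \sum_l F l = \sum_(i < #|T|) F (enum_val i).
  by rewrite -(big_enum_val F).
have normE n (w : 'I_n -> T -> R) c : 0 < c -> (forall i, \sum_l w i l ^+ 2 <= c ^+ 2) ->
    forall i, \sum_(l < #|T|) (c^-1 * w i (enum_val l)) ^+ 2 <= 1.
  move=> c0 wc i; under eq_bigr do rewrite exprMn.
  rewrite -mulr_sumr -(enumE (fun l => w i l ^+ 2)) exprVn mulrC.
  by rewrite ler_pdivrMr ?mul1r // exprn_gt0.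
have := HS _ _ _ (normE _ u a a0 ua) (normE _ v b b0 vb).
under eq_bigr do rewrite bilinZ.
rewrite -mulr_sumr -(enumE (fun l => bilin (u^~ l) (v^~ l))) -invfM mulrC.
by rewrite ler_pdivrMr // mulr_gt0.
Qed.

(* Replace u_i, v_j by the Rademacher sums they define and clip these at height 2:
   the clipped parts are bounded by 4 W pointwise, and by the fourth moment the
   remainders are vectors of small norm, to which the bound S applies again. *)
Lemma inner_bound_step (W S : R) :
  (forall (s : 'I_m1 -> bool) (t : 'I_m2 -> bool),
     bilin (fun i => (-1) ^+ s i) (fun j => (-1) ^+ t j) <= W) ->
  inner_bound S -> inner_bound (4 * W + S / 2).
Proof.
move=> HW HS k u v u1 v1.
set N : R := 2 ^+ k.
have N0 : 0 < N by rewrite exprn_gt0.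
pose p i (e : cube k) := rad (u i) e; pose q j (e : cube k) := rad (v j) e.
have E1 : \sum_e bilin (p^~ e) (q^~ e) = N * \sum_l bilin (u^~ l) (v^~ l).
  rewrite /bilin exchange_big /= [in RHS]exchange_big mulr_sumr /=; apply: eq_bigr => i _.
  rewrite exchange_big /= [in RHS]exchange_big mulr_sumr /=; apply: eq_bigr => j _.
  by rewrite -!mulr_sumr sum_rad_mul -/N; ring.
have n2 n (w : 'I_n -> 'I_k -> R) i : \sum_l w i l ^+ 2 <= 1 ->
    \sum_e rad (w i) e ^+ 2 <= N.
  move=> w1; under eq_bigr do rewrite expr2.
  by rewrite sum_rad_mul ler_piMr ?(ltW N0) //.
have n4 n (w : 'I_n -> 'I_k -> R) i : \sum_l w i l ^+ 2 <= 1 ->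
    \sum_e (rad (w i) e - clip (rad (w i) e)) ^+ 2 <= N / 16.
  move=> w1; have h : 0 <= \sum_l w i l ^+ 2 by apply: sumr_ge0 => l _; exact: sqr_ge0.
  apply: (@le_trans _ _ (\sum_e rad (w i) e ^+ 4 / 64)).
    by apply: ler_sum => e _; exact: clip_dist.
  rewrite -mulr_suml; have := sum_rad_exp4 (w i).
  have : N * (\sum_i0 w i i0 ^+ 2) ^+ 2 <= N.
    by rewrite ler_piMr ?(ltW N0) // expr_le1.
  rewrite -/N; lra.
(* The common norm bound after balancing: twice a remainder has squared norm at most [4 * N / 16],
   half of a Rademacher sum or of its clipping at most [N / 4]. The two remainder terms then cost
   [S * N / 4] each. *)
set r := Num.sqrt N / 2.
have r0 : 0 < r by rewrite divr_gt0 // sqrtr_gt0.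
have rr : r ^+ 2 = N / 4 by rewrite /r exprMn sqr_sqrtr ?(ltW N0) //; lra.
have A1 : \sum_e bilin (clip \o (p^~ e)) (clip \o (q^~ e)) <= 4 * W * N.
  rewrite -[N]sum_cube1 mulr_sumr; apply: ler_sum => e _; rewrite mulr1.
  have := @bilin_sign_bound W HW (fun i => 2^-1 * clip (p i e)) (fun j => 2^-1 * clip (q j e)).
  rewrite bilinZ => H; suff : 2^-1 * 2^-1 * bilin (clip \o p^~ e) (clip \o q^~ e) <= W by lra.
  by apply: H => i; rewrite normrM ger0_norm // ler_pdivrMl // mulr1; exact: clip_abs.
have A2 : \sum_e bilin (fun i => 2 * (p i e - clip (p i e))) (fun j => 2^-1 * q j e)
    <= S * (r * r).
  apply: (@inner_bound_scaled S _ (fun i e => 2 * (p i e - clip (p i e))) (fun j e => 2^-1 * q j e)) => // i.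
  - under eq_bigr do rewrite exprMn.
    by rewrite -mulr_sumr rr; have := n4 _ _ _ (u1 i); rewrite /p; lra.
  - under eq_bigr do rewrite exprMn.
    by rewrite -mulr_sumr rr; have := n2 _ _ _ (v1 i); rewrite /q; lra.
have A3 : \sum_e bilin (fun i => 2^-1 * clip (p i e)) (fun j => 2 * (q j e - clip (q j e)))
    <= S * (r * r).
  apply: (@inner_bound_scaled S _ (fun i e => 2^-1 * clip (p i e)) (fun j e => 2 * (q j e - clip (q j e)))) => // i.
  - under eq_bigr do rewrite exprMn.
    rewrite -mulr_sumr rr.
    have : \sum_e clip (p i e) ^+ 2 <= \sum_e p i e ^+ 2.
      by apply: ler_sum => e _; exact: clip_sqr_le.
    by have := n2 _ _ _ (u1 i); rewrite /p; lra.
  - under eq_bigr do rewrite exprMn.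
    by rewrite -mulr_sumr rr; have := n4 _ _ _ (v1 i); rewrite /q; lra.
(* Pointwise, [p q = clip p * clip q + (p - clip p) * q + clip p * (q - clip q)]. *)
have E2 : \sum_e bilin (p^~ e) (q^~ e) =
   \sum_e bilin (clip \o (p^~ e)) (clip \o (q^~ e)) +
   \sum_e bilin (fun i => 2 * (p i e - clip (p i e))) (fun j => 2^-1 * q j e) +
   \sum_e bilin (fun i => 2^-1 * clip (p i e)) (fun j => 2 * (q j e - clip (q j e))).
  rewrite -!big_split /=; apply: eq_bigr => e _; rewrite /bilin -!big_split /=.
  apply: eq_bigr => i _; rewrite -!big_split /=; apply: eq_bigr => j _; rewrite /comp; lra.
rewrite -expr2 rr in A2 A3.
suff : N * \sum_l bilin (u^~ l) (v^~ l) <= N * (4 * W + S / 2) by rewrite ler_pM2l.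
by rewrite -E1 E2; lra.
Qed.

(** A crude bound, needed so that the set of valid bounds is nonempty and has an infimum. *)
Lemma inner_bound_abs : inner_bound (\sum_i \sum_j `|M i j|).
Proof.
move=> k u v u1 v1; rewrite /bilin exchange_big /=; apply: ler_sum => i _.
rewrite exchange_big /=; apply: ler_sum => j _; rewrite -mulr_sumr.
apply: le_trans (ler_norm _) _; rewrite normrM ler_piMr // ler_norml.
have cs (e : R) : e ^+ 2 = 1 -> e * \sum_l u i l * v j l <= 1.
  move=> e1; apply: (@le_trans _ _ (\sum_l (u i l ^+ 2 + v j l ^+ 2) / 2)).
    rewrite mulr_sumr; apply: ler_sum => l _.
    have := sqr_ge0 (u i l - e * v j l).
    rewrite sqrrB exprMn e1; lra.
  by rewrite -mulr_suml big_split /=; have := u1 i; have := v1 j; lra.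
have := cs 1 (expr1n _ _); have := cs (-1) (sqrr_sign _ 1).
lra.
Qed.

(** The best bound [K = inf A] satisfies [K <= 4 W + K / 2] by [inner_bound_step], hence
    [K <= 8 W]. *)
Theorem grothendieck (W : R) :
  (forall (s : 'I_m1 -> bool) (t : 'I_m2 -> bool),
     bilin (fun i => (-1) ^+ s i) (fun j => (-1) ^+ t j) <= W) ->
  inner_bound (8 * W).
Proof.
move=> HW.
pose A := [set S : R | inner_bound S]%classic.
(* Vectors of dimension 0 give an empty sum, so every valid bound is nonnegative. *)
have lbA : lbound A 0.
  move=> S HS; rewrite -[0](big_ord0 _ +%R xpredT (fun=> bilin (fun=> 0) (fun=> 0))).
  by apply: (HS 0%N (fun _ _ => 0) (fun _ _ => 0)) => i; rewrite big_ord0.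
have hA : has_inf A by split; [exists (\sum_i \sum_j `|M i j|); exact: inner_bound_abs|exists 0].
have H : 2 * (inf A - 4 * W) <= inf A.
  apply: lb_le_inf; first exact: hA.1.
  move=> S HS; have : inf A <= 4 * W + S / 2.
    by apply: ge_inf; [exact: hA.2|exact: inner_bound_step].
  lra.
move=> k u v u1 v1; apply: le_trans (_ : inf A <= _); last lra.
by apply: lb_le_inf; [exact: hA.1|move=> S; apply].
Qed.

End Form.
End Grothendieck.

(** * Almost D-optimal designs *)

(** The same two block matrices multiplied in either order have equal determinants; each product is
    block triangular, and the two sides are read off. *)
Lemma det_add1_rank1 (F : comUnitRingType) n (x : 'cV[F]_n) (y : 'rV[F]_n) :
  \det (1%:M + x *m y) = 1 + (y *m x) 0 0.
Proof.
have E : block_mx 1%:M (- x) y 1%:M *m block_mx 1%:M x 0 1%:M =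
         block_mx 1%:M 0 y (1%:M + y *m x) :> 'M[F]_(n + 1).
  by rewrite mulmx_block !mul1mx !mulmx1 !mulmx0 !addr0 subrr addrC.
have E' : block_mx 1%:M x 0 1%:M *m block_mx 1%:M (- x) y 1%:M =
         block_mx (1%:M + x *m y) 0 y 1%:M :> 'M[F]_(n + 1).
  by rewrite mulmx_block !mul1mx !mulmx1 !mul0mx !add0r addNr.
have := congr1 determinant E'; have := congr1 determinant E.
rewrite !det_mulmx mulrC => -> ; rewrite !det_lblock !det1 mulr1 mul1r => <-.
by rewrite det_mx11 !mxE eqxx.
Qed.

Lemma bernoulli_ge (R : realDomainType) (t : R) n : 0 <= t -> t <= 1 ->
  1 - n%:R * t <= (1 - t) ^+ n.
Proof.
move=> t0 t1; elim: n => [|n IH]; first by rewrite expr0; lra.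
rewrite exprS -natr1.
have : (1 - t) * (1 - n%:R * t) <= (1 - t) * (1 - t) ^+ n by rewrite ler_wpM2l // subr_ge0.
have : 0 <= n%:R * (t * t) by rewrite !mulr_ge0.
lra.
Qed.

Section Design.
Variable R : realType.

Definition gram m r (U : 'M[R]_(m, r)) (c : 'rV[R]_m) : 'M[R]_r := U^T *m diag_mx c *m U.

Definition simplex m : set 'rV[R]_m :=
  [set c | (forall i, 0 <= c 0 i) /\ \sum_i c 0 i = 1]%classic.
Arguments simplex : clear implicits.

(** For invertible [gram U c], this minus [r] is the derivative of the log-determinant of the Gram
    matrix when [c] moves towards vertex [i]. *)
Definition leverage m r (U : 'M[R]_(m, r)) (c : 'rV[R]_m) (i : 'I_m) : R :=
  (row i U *m invmx (gram U c) *m (row i U)^T) 0 0.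

Lemma gram_mix m r (U : 'M[R]_(m, r)) c t i :
  gram U ((1 - t) *: c + t *: delta_mx 0 i) =
  (1 - t) *: gram U c + t *: ((row i U)^T *m row i U).
Proof.
rewrite /gram raddfD /= !linearZ /= mulmxDr mulmxDl -!scalemxAr -!scalemxAl.
congr (_ + _ *: _); rewrite (_ : diag_mx (delta_mx 0 i) = (delta_mx 0 i)^T *m delta_mx (0 : 'I_1) i).
  by rewrite mulmxA -trmx_mul -mulmxA -!rowE.
rewrite trmx_delta mul_delta_mx; apply/matrixP => a b; rewrite !mxE eqxx /=.
by case: (eqVneq a b) => [<-|ne]; rewrite ?mulr1n ?mulr0n ?andbb //;
  case: (eqVneq a i) ne => // <-; rewrite eq_sym => /negbTE ->.
Qed.

Lemma simplex_mix m (c : 'rV[R]_m) t i : 0 <= t <= 1 -> simplex m c ->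
  simplex m ((1 - t) *: c + t *: delta_mx 0 i).
Proof.
move=> /andP[t0 t1] [c0 c1]; split=> [j|].
  by rewrite !mxE addr_ge0 // mulr_ge0 // subr_ge0.
under eq_bigr do rewrite !mxE.
rewrite big_split /= -!mulr_sumr c1 (bigD1 i) //= !eqxx big1 => [|j /negbTE ->].
  by rewrite addr0 !mulr1 subrK.
by [].

Qed.

(** Factoring out the old Gram matrix leaves a rank-one perturbation of the identity. In dimension
    [r.+1] one factor [1 - t] clears its denominator. *)
Lemma det_gram_mix m r (U : 'M[R]_(m, r.+1)) c t i : gram U c \in unitmx -> t < 1 ->
  \det (gram U ((1 - t) *: c + t *: delta_mx 0 i)) =
  (1 - t) ^+ r * (1 - t + t * leverage U c i) * \det (gram U c).
Proof.
rewrite gram_mix /leverage; move: (gram U c) (row i U) => M u uM t1.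
have t0 : 1 - t != 0 by rewrite subr_eq0 gt_eqF.
have -> : (1 - t) *: M + t *: (u^T *m u) =
   (1 - t) *: (M *m (1%:M + ((t / (1 - t)) *: (invmx M *m u^T)) *m u)).
  rewrite mulmxDr mulmx1 -scalemxAl -scalemxAr -mulmxA mulKVmx // scalerDr scalerA.
  by rewrite mulrC divfK.
rewrite detZ det_mulmx det_add1_rank1 -scalemxAr mxE mulmxA exprS.
by field.
Qed.

Lemma gramE m r (U : 'M[R]_(m, r)) c i j : gram U c i j = \sum_l c 0 l * (U l i * U l j).
Proof.
by rewrite mxE; apply: eq_bigr => l _; rewrite mul_mx_diag !mxE; ring.
Qed.

Lemma det_gram_bounded m r (U : 'M[R]_(m, r)) :
  exists B, forall c, simplex m c -> `|\det (gram U c)| <= B.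
Proof.
pose b := \sum_l \sum_i \sum_j `|U l i * U l j|.
exists (\sum_(s : 'S_r) b ^+ r) => c [c0 c1].
apply: le_trans (ler_norm_sum _ _ _) _; apply: ler_sum => s _.
rewrite normrM normrX normrN1 expr1n mul1r normr_prod.
rewrite -[r in b ^+ r]card_ord -prodr_const; apply: ler_prod => i _.
rewrite normr_ge0 /= gramE; apply: le_trans (ler_norm_sum _ _ _) _.
apply: ler_sum => l _; rewrite normrM.
apply: (@le_trans _ _ (`|U l i * U l (s i)|)).
  rewrite ler_piMl // ger0_norm // -c1 (bigD1 l) //= lerDl.
  by apply: sumr_ge0.
rewrite (bigD1 i) //= (bigD1 (s i)) //= -addrA lerDl addr_ge0 //; first exact: sumr_ge0.
by apply: sumr_ge0 => k _; apply: sumr_ge0.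
Qed.

(** A kernel vector [v] makes the sum of squares of [v *m U^T] vanish. This makes the supremum of
    the determinants positive. *)
Lemma gram_const_unit m r (U : 'M[R]_(m, r)) : (0 < m)%N -> row_free U^T ->
  gram U (const_mx m%:R^-1) \in unitmx.
Proof.
move=> m0 Ufree; rewrite /gram diag_const_mx mul_mx_scalar -scalemxAl.
rewrite unitmxZ ?unitfE ?invr_eq0 ?pnatr_eq0 -?lt0n //.
rewrite -row_free_unit; apply: inj_row_free => v v0.
have : (v *m U^T) *m (v *m U^T)^T = 0 by rewrite trmx_mul trmxK mulmxA -(mulmxA v) v0 mul0mx.
move/matrixP/(_ 0 0); rewrite mxE [RHS]mxE => /eqP.
rewrite psumr_eq0 => [|j _]; last by rewrite [X in _ * X]mxE -expr2 sqr_ge0.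
move=> /allP H; apply: (row_free_inj Ufree); rewrite mul0mx; apply/rowP => j.
have := H j (mem_index_enum _); rewrite [X in _ * X]mxE mulf_eq0 orbb => /eqP ->.
by rewrite mxE.
Qed.

(* Kiefer-Wolfowitz: moving an almost maximizer c of |det gram| towards the vertex i
   cannot increase the determinant much, which bounds the leverage of i. *)
Lemma design_exists m r (U : 'M[R]_(m, r.+1)) (e : R) : (0 < m)%N -> row_free U^T ->
  0 < e <= 1 ->
  exists2 c, simplex m c & gram U c \in unitmx /\ forall i, leverage U c i <= r.+1%:R + e.
Proof.
move=> m0 Ufree /andP[e0 e1].
pose A : set R := [set x | exists2 c, simplex m c & x = `|\det (gram U c)|]%classic.
have [B HB] := det_gram_bounded U.
have s0 : simplex m (const_mx m%:R^-1).
  split=> [i|]; first by rewrite mxE invr_ge0.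
  under eq_bigr do rewrite mxE.
  by rewrite sumr_const card_ord -[_ *+ _]mulr_natl divff // pnatr_eq0 -lt0n.
have hA : has_sup A.
  split; first by exists `|\det (gram U (const_mx m%:R^-1))|, (const_mx m%:R^-1).
  by exists B => x [c sc ->]; exact: HB.
have D0 : 0 < sup A.
  have := gram_const_unit m0 Ufree; rewrite unitmxE unitfE -normr_gt0 => h.
  by apply: lt_le_trans h _; apply: (ub_le_sup hA.2); exists (const_mx m%:R^-1).
set n : R := r%:R; have n0 : 0 <= n by rewrite /n.
(* Small enough that [(1 - n t) (1 + t (n + e)) = 1 + t e - t^2 n (n + e)] is at least
   [1 + t e / 2], which is [1 + s] below. *)
pose t := e / (2 * (n + 1) * (n + 1 + e)).
have den0 : 0 < 2 * (n + 1) * (n + 1 + e) by rewrite !mulr_gt0 //; lra.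
have tE : t * (2 * (n + 1) * (n + 1 + e)) = e by rewrite /t divfK // gt_eqF.
have t0 : 0 < t by rewrite divr_gt0.
have nt : n * t <= 1 / 2.
  rewrite mulrC -(@ler_pM2r _ (2 * (n + 1) * (n + 1 + e))) // mulrAC tE.
  nra.
have t1 : t <= 1 / 2.
  by rewrite -(@ler_pM2r _ (2 * (n + 1) * (n + 1 + e))) // tE; nra.
have te1 : t * (n * (n + e)) <= e / 2.
  have : 0 <= t * (2 * n + 1 + e) by rewrite mulr_ge0 ?ltW //; lra.
  lra.
pose s := t * e / 2.
have s0' : 0 < s by rewrite /s divr_gt0 // mulr_gt0.
have s1 : s <= 1 by rewrite /s; nra.
(* The choice of [c] loses a factor [1 - s / 2]; a leverage that is too large would gain [1 + s],
   and [(1 + s) (1 - s / 2) >= 1] contradicts the supremum. *)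
have dA : 0 < s / 2 * sup A by rewrite mulr_gt0 // divr_gt0.
have [_ [c sc ->] Hc] := sup_adherent dA hA.
have det0 : 0 < `|\det (gram U c)|.
  by apply: le_lt_trans Hc; have := ltW D0; nra.
have uM : gram U c \in unitmx by rewrite unitmxE unitfE -normr_gt0.
exists c => //; split=> // i; rewrite leNgt; apply/negP => q_gt.
have t1' : t < 1 by lra.
have mixP : simplex m ((1 - t) *: c + t *: delta_mx 0 i) by apply: simplex_mix => //; lra.
have : `|\det (gram U ((1 - t) *: c + t *: delta_mx 0 i))| <= sup A.
  by apply: (ub_le_sup hA.2); exists ((1 - t) *: c + t *: delta_mx 0 i).
rewrite (det_gram_mix _ uM t1') normrM.
set q := leverage U c i; set d := `|\det _|; rewrite -/d in Hc det0.
rewrite -natr1 -/n -/q in q_gt.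
have b1 : 1 - n * t <= (1 - t) ^+ r by apply: bernoulli_ge; lra.
have b2 : 1 + t * (n + e) <= 1 - t + t * q by nra.
have b3 : 1 + s <= (1 - t) ^+ r * (1 - t + t * q).
  apply: (@le_trans _ _ ((1 - n * t) * (1 + t * (n + e)))).
    have : t * (t * (n * (n + e))) <= t * (e / 2) by rewrite ler_pM2l.
    rewrite /s; lra.
  by apply: ler_pM => //; nra.
have b4 : 1 + s <= `|(1 - t) ^+ r * (1 - t + t * q)| by apply: le_trans b3 (ler_norm _).
move=> H; have : (1 + s) * d <= sup A by apply: le_trans H; rewrite ler_pM2r.
have : (1 - s / 2) * sup A < d by lra.
move=> h1 h2; have h3 : (1 + s) * ((1 - s / 2) * sup A) < sup A.
  by apply: lt_le_trans h2; rewrite ltr_pM2l //; lra.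
have : 0 <= (s - s * s) * sup A by rewrite mulr_ge0 ?ltW //; nra.
lra.
Qed.

(** With [P = C G^-1 C^T], the identity [P diag(c) C = C] gives both [U V^T = X] and [U U^T = P]. So
    squared row norms of [U] are leverages, and those of [V] are [c]-averages of squared entries of
    [X]. *)
Lemma balanced_factorization m1 m2 (X : 'M[R]_(m1, m2)) (g e : R) :
  (0 < \rank X)%N -> (forall i j, `|X i j| <= g) -> 0 < e <= 1 ->
  exists (U : 'M[R]_(m1, m1)) (V : 'M[R]_(m2, m1)),
  [/\ X = U *m V^T, forall i, \sum_l U i l ^+ 2 <= (\rank X)%:R + e &
      forall j, \sum_l V j l ^+ 2 <= g ^+ 2].
Proof.
move=> rk0 Xg e01.
have m0 : (0 < m1)%N by apply: leq_trans rk0 (rank_leq_row X).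
have XE := mulmx_base X.
have Cfree : row_free (col_base X)^T by rewrite -row_leq_rank mxrank_tr col_leq_rank col_base_full.
move: (\rank X) rk0 (col_base X) (row_base X) XE Cfree => [//|r] _ C W XE Cfree.
have [c [c0 c1] [uM lev]] := design_exists m0 Cfree e01.
pose D : 'M[R]_m1 := diag_mx (map_mx Num.sqrt c).
have DD : D *m D^T = diag_mx c.
  rewrite tr_diag_mx mulmx_diag; congr diag_mx; apply/rowP => l.
  by rewrite !mxE -expr2 sqr_sqrtr.
pose U := C *m invmx (gram C c) *m C^T *m D.
pose V := X^T *m D.
have XUV : X = U *m V^T.
  rewrite /U /V trmx_mul trmxK mulmxA -(mulmxA _ D) DD.
  have -> : C *m invmx (gram C c) *m C^T *m diag_mx c *m X =
      C *m invmx (gram C c) *m gram C c *m W by rewrite -{1}XE /gram !mulmxA.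
  by rewrite mulmxKV.
exists U, V; split=> // [i|j].
  have -> : \sum_l U i l ^+ 2 = (U *m U^T) i i.
    by rewrite mxE; apply: eq_bigr => l _; rewrite [X in _ * X]mxE expr2.
  apply: le_trans (lev i); rewrite le_eqVlt; apply/orP; left; apply/eqP.
  rewrite /U trmx_mul -mulmxA (mulmxA D) DD.
  have -> : C *m invmx (gram C c) *m C^T *m (diag_mx c *m (C *m invmx (gram C c) *m C^T)^T)
     = C *m invmx (gram C c) *m C^T.
    rewrite !trmx_mul trmxK !mulmxA.
    have -> : C *m invmx (gram C c) *m C^T *m diag_mx c *m C =
      C *m invmx (gram C c) *m gram C c by rewrite /gram !mulmxA.
    rewrite mulmxKV // trmx_inv; congr (_ *m invmx _ *m _).
    by rewrite /gram !trmx_mul trmxK tr_diag_mx mulmxA.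
  by rewrite /leverage -row_mul !mxE; apply: eq_bigr => l _; rewrite !mxE.
have -> : \sum_l V j l ^+ 2 = \sum_l c 0 l * X l j ^+ 2.
  apply: eq_bigr => l _; rewrite /V mul_mx_diag !mxE exprMn sqr_sqrtr //; ring.
rewrite -[g ^+ 2]mul1r -c1 mulr_suml; apply: ler_sum => l _.
rewrite ler_wpM2l // -[X in X <= _]real_normK ?num_real // lerXn2r ?nnegrE //.
exact: le_trans (Xg l j).
Qed.

End Design.

(** * Rademacher averages *)

Section MaxOverFinType.
Variables (R : realType) (T : finType) (t0 : T).

(** The default is a value of [F], so this is the true maximum even when [F] is negative. *)
Definition maxF (F : T -> R) : R := \big[Num.max/F t0]_t F t.

Lemma maxF_ge F t : F t <= maxF F. Proof. exact: le_bigmax. Qed.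

Lemma maxF_le F x : (forall t, F t <= x) -> maxF F <= x.
Proof. by move=> Fx; apply: bigmax_le. Qed.

Lemma maxF_sum (S : finType) (w : S -> R) (F : S -> T -> R) : (forall s, 0 <= w s) ->
  maxF (fun t => \sum_s w s * F s t) <= \sum_s w s * maxF (F s).
Proof.
move=> w0; apply: maxF_le => t; apply: ler_sum => s _.
by apply: ler_wpM2l => //; exact: maxF_ge.
Qed.

Lemma maxFD_le F G x : (forall t s, F t + G s <= x) -> maxF F + maxF G <= x.
Proof.
move=> FGx; rewrite -lerBrDr; apply: maxF_le => t.
rewrite lerBrDr addrC -lerBrDr; apply: maxF_le => s.
by rewrite lerBrDr addrC.
Qed.

End MaxOverFinType.

Section Rademacher.
Variables (R : realType) (n : nat).
Local Notation signs := {ffun 'I_n -> bool}.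

Definition flip (k : 'I_n) (e : signs) : signs := [ffun i => (i == k) (+) e i].
Definition negs (e : signs) : signs := [ffun i => ~~ e i].

Lemma flipK k : involutive (flip k).
Proof. by move=> e; apply/ffunP => i; rewrite !ffunE addKb. Qed.

Lemma negsK : involutive negs.
Proof. by move=> e; apply/ffunP => i; rewrite !ffunE negbK. Qed.

Lemma sum_signs1 : \sum_(e : signs) 1 = 2 ^+ n :> R.
Proof. by rewrite sumr_const card_ffun card_bool card_ord natrX. Qed.

(** * Contraction principle for Rademacher averages *)

Section Contraction.
Variables (T : finType) (t0 : T).

Definition radmax (a : 'I_n -> T -> R) (e : signs) : R :=
  maxF t0 (fun t => \sum_i (-1) ^+ e i * a i t).

(** Pair each [e] with its flip at [k]. The two maxima add up to a maximum over pairs [(t, s)] of a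
    difference of [b k] plus [A t + A s]; since the latter is symmetric, the larger difference of
    [a k] is reached by ordering the pair suitably. *)
Lemma contraction_step k (a b : 'I_n -> T -> R) :
  (forall t s, `|b k t - b k s| <= `|a k t - a k s|) ->
  (forall i, i != k -> a i =1 b i) ->
  \sum_e radmax b e <= \sum_e radmax a e.
Proof.
move=> Lip eqab.
have dbl c : \sum_e radmax c e = (\sum_e (radmax c e + radmax c (flip k e))) / 2.
  rewrite big_split /= [X in (_ + X) / 2](_ : _ = \sum_e radmax c e); first lra.
  by rewrite [RHS](reindex_inj (inv_inj (flipK k))).
rewrite !dbl ler_pM2r //; apply: ler_sum => e _.
pose A t := \sum_(i | i != k) (-1) ^+ e i * b i t.
have E1 c : (forall i, i != k -> c i =1 b i) ->
    radmax c e = maxF t0 (fun t => (-1) ^+ e k * c k t + A t).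
  move=> cb; congr maxF; apply: boolp.funext => t; rewrite (bigD1 k) //=; congr (_ + _).
  by apply: eq_bigr => i ik; rewrite cb.
have E2 c : (forall i, i != k -> c i =1 b i) ->
    radmax c (flip k e) = maxF t0 (fun t => - ((-1) ^+ e k * c k t) + A t).
  move=> cb; congr maxF; apply: boolp.funext => t; rewrite (bigD1 k) //=; congr (_ + _).
    by rewrite ffunE eqxx /= signrN mulNr.
  by apply: eq_bigr => i ik; rewrite ffunE (negbTE ik) cb.
rewrite (E1 b) // (E2 b) // (E1 a) // (E2 a) //; apply: maxFD_le => t s.
have Hp : forall u, (-1) ^+ e k * a k u + A u <= maxF t0 (fun t => (-1) ^+ e k * a k t + A t).
  by move=> u; exact: (maxF_ge t0 (fun t => (-1) ^+ e k * a k t + A t)).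
have Hm : forall u, - ((-1) ^+ e k * a k u) + A u <=
    maxF t0 (fun t => - ((-1) ^+ e k * a k t) + A t).
  by move=> u; exact: (maxF_ge t0 (fun t => - ((-1) ^+ e k * a k t) + A t)).
have := Hp t; have := Hp s; have := Hm t; have := Hm s.
move: (maxF _ _) (maxF _ _) => p m.
have := ler_norm (b k t - b k s); have := ler_norm (b k s - b k t); rewrite distrC.
move: (Lip t s); case: (ger0P (a k t - a k s)) => _; case: (e k); rewrite ?expr1 ?expr0; lra.
Qed.

Lemma contraction (a b : 'I_n -> T -> R) :
  (forall i t s, `|b i t - b i s| <= `|a i t - a i s|) ->
  \sum_e radmax b e <= \sum_e radmax a e.
Proof.
(* Hybrid families: [b] is replaced by [a] one coordinate at a time. *)
move=> Lip; pose h j (i : 'I_n) t := if (i < j)%N then a i t else b i t.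
have Hj j : (j <= n)%N -> \sum_e radmax b e <= \sum_e radmax (h j) e.
  elim: j => [_|j IH jn]; first by rewrite /h.
  apply: le_trans (IH (ltnW jn)) _.
  apply: (@contraction_step (Ordinal jn)) => [t s|i ij t]; rewrite /h.
    by rewrite ltnn ltnS leqnn.
  rewrite ltnS leq_eqVlt (_ : (i == j :> nat) = false) //.
  by apply: contraNF ij => /eqP ij; apply/eqP/val_inj.
apply: le_trans (Hj n (leqnn n)) _; rewrite le_eqVlt; apply/orP; left; apply/eqP.
apply: eq_bigr => e _; congr maxF; apply: boolp.funext => t; apply: eq_bigr => i _.
by rewrite /h ltn_ord.
Qed.

(** * Symmetrization with an independent ghost sample *)

Section Symmetrization.
Variables (Z : finType) (p : Z -> R) (h : T -> Z -> R).
Hypothesis p0 : forall z, 0 <= p z.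
Hypothesis p1 : \sum_z p z = 1.
Local Notation samples := {ffun 'I_n -> Z}.

Definition prodp (S : samples) : R := \prod_i p (S i).

Lemma prodp_ge0 S : 0 <= prodp S. Proof. by apply: prodr_ge0. Qed.

Lemma sum_prodp : \sum_S prodp S = 1.
Proof. by rewrite /prodp -(bigA_distr_bigA (fun _ : 'I_n => p)) /= big1. Qed.

Lemma prodp_marginal (g : Z -> R) i : \sum_S prodp S * g (S i) = \sum_z p z * g z.
Proof.
pose F j z := p z * (if j == i then g z else 1).
transitivity (\sum_(S : samples) \prod_j F j (S j)).
  apply: eq_bigr => S _; rewrite big_split /=; congr (_ * _).
  by rewrite -big_mkcond big_pred1_eq.
rewrite -(bigA_distr_bigA F) (bigD1 i) //= [X in _ * X]big1 ?mulr1; first by apply: eq_bigr => z _; rewrite /F eqxx.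
by move=> j /negbTE ji; rewrite -[RHS]p1; apply: eq_bigr => z _; rewrite /F ji mulr1.
Qed.

Definition swap (e : signs) (SS : samples * samples) : samples * samples :=
  ([ffun i => if e i then SS.2 i else SS.1 i], [ffun i => if e i then SS.1 i else SS.2 i]).

Lemma swapK e : involutive (swap e).
Proof.
by move=> [S S']; congr pair; apply/ffunP => i; rewrite !ffunE /=; case: (e i).
Qed.

Lemma prodp_swap e SS : prodp (swap e SS).1 * prodp (swap e SS).2 = prodp SS.1 * prodp SS.2.
Proof.
rewrite /prodp -!big_split /=; apply: eq_bigr => i _; rewrite !ffunE.
by case: (e i) => //; rewrite mulrC.
Qed.

(** The mean is an average over a ghost sample, which Jensen's inequality moves outside the maximum.
    Exchanging observations between the samples preserves the product law and inserts signs; each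
    sample then contributes one Rademacher average. *)
Lemma symmetrization :
  \sum_S prodp S * maxF t0 (fun t => \sum_(i < n) ((\sum_z p z * h t z) - h t (S i)))
  <= 2 * \sum_S prodp S * (2 ^- n * \sum_e radmax (fun i t => h t (S i)) e).
Proof.
pose G (SS : samples * samples) := maxF t0 (fun t => \sum_(i < n) (h t (SS.2 i) - h t (SS.1 i))).
pose Ge (e : signs) (SS : samples * samples) :=
  maxF t0 (fun t => \sum_(i < n) (-1) ^+ e i * (h t (SS.2 i) - h t (SS.1 i))).
pose P2 (SS : samples * samples) := prodp SS.1 * prodp SS.2.
have P20 SS : 0 <= P2 SS by rewrite mulr_ge0 // prodp_ge0.
apply: (@le_trans _ _ (\sum_SS P2 SS * G SS)).
  rewrite -(pair_bigA _ (fun S S' => P2 (S, S') * G (S, S'))) /=; apply: ler_sum => S _.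
  rewrite /P2 /=; under [leRHS]eq_bigr do rewrite -mulrA.
  rewrite -[leRHS]mulr_sumr ler_wpM2l ?prodp_ge0 //.
  apply: le_trans (maxF_sum _ _ _); last exact: prodp_ge0.
  rewrite le_eqVlt; apply/orP; left; apply/eqP; congr maxF; apply: boolp.funext => t.
  under [RHS]eq_bigr do rewrite mulr_sumr.
  rewrite exchange_big /=; apply: eq_bigr => i _.
  under [RHS]eq_bigr do rewrite mulrBr.
  by rewrite sumrB (prodp_marginal (h t)) -mulr_suml sum_prodp mul1r.
have GE e : \sum_SS P2 SS * G SS = \sum_SS P2 SS * Ge e SS.
  rewrite (reindex_inj (inv_inj (swapK e))) /=; apply: eq_bigr => SS _.
  rewrite /P2 prodp_swap; congr (_ * _); congr maxF; apply: boolp.funext => t.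
  by apply: eq_bigr => i _; rewrite !ffunE; case: (e i); rewrite ?expr1 ?expr0; ring.
have -> : \sum_SS P2 SS * G SS = 2 ^- n * \sum_e \sum_SS P2 SS * Ge e SS.
  rewrite [X in 2 ^- n * X](eq_bigr (fun=> 1 * \sum_SS P2 SS * G SS)).
    by rewrite -mulr_suml sum_signs1 mulrA mulVf ?mul1r // expf_neq0.
  by move=> e _; rewrite mul1r -GE.
pose rS (S : samples) := \sum_e radmax (fun i t => h t (S i)) e.
have H : \sum_e \sum_SS P2 SS * Ge e SS <= \sum_SS P2 SS * (rS SS.2 + rS SS.1).
  rewrite exchange_big /=; apply: ler_sum => SS _; rewrite -mulr_sumr ler_wpM2l //.
  (* The first sample enters with a minus sign, absorbed by negating all signs. *)
  have -> : rS SS.1 = \sum_e radmax (fun i t => h t (SS.1 i)) (negs e).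
    by rewrite /rS (reindex_inj (inv_inj negsK)).
  rewrite /rS -big_split /=; apply: ler_sum => e _; apply: maxF_le => t.
  under eq_bigr do rewrite mulrBr.
  rewrite sumrB lerD //; first exact: (maxF_ge t0 (fun t => \sum_i (-1) ^+ e i * h t (SS.2 i))).
  apply: le_trans (maxF_ge t0 (fun t => \sum_i (-1) ^+ negs e i * h t (SS.1 i)) t).
  rewrite -sumrN le_eqVlt; apply/orP; left; apply/eqP; apply: eq_bigr => i _.
  by rewrite ffunE signrN mulNr.
apply: le_trans (ler_wpM2l _ H) _; first by rewrite invr_ge0 exprn_ge0.
rewrite le_eqVlt; apply/orP; left; apply/eqP.
under eq_bigr do rewrite mulrDr; rewrite big_split /=.
have -> : \sum_SS P2 SS * rS SS.2 = \sum_S prodp S * rS S.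
  rewrite -(pair_bigA _ (fun S S' => P2 (S, S') * rS S')) /= exchange_big /=.
  apply: eq_bigr => S' _; rewrite /P2 /=; under eq_bigr do rewrite -mulrA.
  by rewrite -mulr_suml sum_prodp mul1r.
have -> : \sum_SS P2 SS * rS SS.1 = \sum_S prodp S * rS S.
  rewrite -(pair_bigA _ (fun S S' => P2 (S, S') * rS S)) /=.
  apply: eq_bigr => S _; rewrite /P2 /=; under eq_bigr do rewrite mulrAC.
  by rewrite -mulr_sumr sum_prodp mulr1.
under [in RHS]eq_bigr do rewrite mulrCA; rewrite -mulr_sumr; ring.
Qed.

End Symmetrization.
End Contraction.

(** From [expR y <= 1 / (1 - y)] the left side is at most [2 / (1 - x^2)], hence at most
    [2 (1 + 2 x^2)] in this range. *)
Lemma cosh_le (x : R) : x ^+ 2 <= 1 / 2 -> expR x + expR (- x) <= 2 * expR (2 * x ^+ 2).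
Proof.
move=> x2; have xl : -1 < x < 1 by apply/andP; split; nra.
have inv (y : R) : -1 < y < 1 -> expR y <= (1 - y)^-1.
  move=> /andP[y1 y2]; rewrite -[y in expR y]opprK expRN lef_pV2 ?posrE ?expR_gt0 //; last lra.
  by have := expR_ge1Dx (- y); lra.
have h1 := inv x xl; have h2 : expR (- x) <= (1 - - x)^-1 by apply: inv; lra.
have h3 := expR_ge1Dx (2 * x ^+ 2).
have h4 : (1 - x)^-1 + (1 - - x)^-1 = 2 / (1 - x ^+ 2).
  by field; rewrite !gt_eqF //; lra.
have h5 : 2 / (1 - x ^+ 2) <= 2 * (1 + 2 * x ^+ 2).
  by rewrite ler_pdivrMr; nra.
lra.
Qed.

(* From [l max <= c - 1 + sum_k exp (l E_k - c)], with l of order sqrt (d / n). *)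
Lemma massart (K : finType) (k0 : K) (s : K -> 'I_n -> bool) (d : R) :
  0 < d -> #|K|%:R <= expR d ->
  2 ^- n * \sum_(e : signs) maxF k0 (fun k => \sum_i (-1) ^+ e i * (-1) ^+ s k i)
  <= 3 * Num.sqrt (d * n%:R).
Proof.
move=> d0 cardK; rewrite ler_pdivrMl ?exprn_gt0 //.
set v := Num.sqrt _.
have v0 : 0 <= v by exact: sqrtr_ge0.
have vv : v ^+ 2 = d * n%:R by rewrite sqr_sqrtr // mulr_ge0 // ltW.
rewrite -sum_signs1 mulr_suml.
(* If [n <= d], the trivial bound [n <= sqrt (d n)] suffices; otherwise [l] is small enough for
   [cosh_le]. *)
case: (lerP n%:R d) => [nd|nd].
  apply: ler_sum => e _; apply: maxF_le => k; rewrite mul1r.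
  apply: (@le_trans _ _ n%:R).
    rewrite -[n in n%:R]card_ord -sumr_const; apply: ler_sum => i _.
    by rewrite -signr_addb; case: (_ (+) _); rewrite ?expr1 ?expr0; lra.
  have : n%:R <= v by rewrite -(@ler_pXn2r _ 2) ?nnegrE // vv expr2 ler_wpM2r.
  lra.
have vp : 0 < v by rewrite sqrtr_gt0 mulr_gt0 //; lra.
pose l := d / (2 * v).
have l0 : 0 < l by rewrite divr_gt0 // mulr_gt0.
have lv : l * v = d / 2 by rewrite /l; field; rewrite gt_eqF.
have l2n : l ^+ 2 * n%:R = d / 4.
  have : l ^+ 2 * n%:R * d = d / 4 * d.
    by rewrite -mulrA [n%:R * d]mulrC -vv -exprMn lv; field.
  by apply: mulIf; rewrite gt_eqF.
have n0 : 0 < n%:R :> R by lra.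
have l2 : l ^+ 2 <= 1 / 2.
  by rewrite -(@ler_pM2r _ n%:R) // l2n; lra.
(* The moment bound costs [expR (2 l^2 n) = expR (d / 2)], so this shift leaves [expR (- d)], which
   cancels the cardinality of [K]. The result is [c / l = 3 v]. *)
pose c := 3 * d / 2.
pose E (e : signs) k := \sum_i (-1) ^+ e i * (-1) ^+ s k i : R.
have Hpt e : maxF k0 (E e) <= l^-1 * (c - 1 + \sum_k expR (l * E e k - c)).
  apply: maxF_le => k; rewrite mulrC ler_pdivlMr // mulrC.
  have := expR_ge1Dx (l * E e k - c).
  have : expR (l * E e k - c) <= \sum_k expR (l * E e k - c).
    by rewrite (bigD1 k) //= lerDl; apply: sumr_ge0 => j _; exact: expR_ge0.
  lra.
apply: (@le_trans _ _ (\sum_(e : signs) l^-1 * (c - 1 + \sum_k expR (l * E e k - c)))).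
  by apply: ler_sum => e _; exact: Hpt.
rewrite -[leLHS]mulr_sumr big_split /= ler_pdivrMl //.
have Hmgf : \sum_(e : signs) \sum_k expR (l * E e k - c) <= 2 ^+ n.
  have mgf k : \sum_(e : signs) expR (l * E e k - c) <= 2 ^+ n * expR (- d).
    have -> : \sum_(e : signs) expR (l * E e k - c) =
        expR (- c) * \sum_(e : signs) \prod_i expR (l * ((-1) ^+ e i * (-1) ^+ s k i)).
      rewrite mulr_sumr; apply: eq_bigr => e _.
      by rewrite exp.expRD mulrC mulr_sumr expR_sum.
    rewrite -(bigA_distr_bigA (fun (i : 'I_n) (b : bool) => expR (l * ((-1) ^+ b * (-1) ^+ s k i)))) /=.
    have -> : \prod_(i < n) \sum_(b : bool) expR (l * ((-1) ^+ b * (-1) ^+ s k i)) =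
        (expR l + expR (- l)) ^+ n.
      rewrite -[n in _ ^+ n]card_ord -prodr_const; apply: eq_bigr => i _; rewrite big_bool /=.
      by case: (s k i); rewrite !(expr1, expr0, mulN1r, mul1r, mulrN, mulr1, opprK) // addrC.
    apply: (@le_trans _ _ (expR (- c) * (2 * expR (2 * l ^+ 2)) ^+ n)).
      rewrite ler_wpM2l ?expR_ge0 // lerXn2r ?nnegrE ?addr_ge0 ?mulr_ge0 ?expR_ge0 //.
      exact: cosh_le.
    rewrite exprMn mulrCA -expRM_natr -exp.expRD; apply: ler_wpM2l; first exact: exprn_ge0.
    by rewrite ler_expR /c; move: l2n; lra.
  rewrite exchange_big /=; apply: le_trans (ler_sum _ (fun k _ => mgf k)) _.
  rewrite sumr_const -[_ *+ _]mulr_natl mulrCA ler_piMr ?exprn_ge0 //.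
  by rewrite expRN ler_pdivrMr ?expR_gt0 // mul1r.
have -> : \sum_(e : signs) (c - 1) = (c - 1) * 2 ^+ n.
  by rewrite -sum_signs1 mulr_sumr; apply: eq_bigr => e _; rewrite mulr1.
have -> : l * (\sum_(e : signs) 1 * (3 * v)) = 3 * (l * v) * 2 ^+ n.
  by rewrite -mulr_suml sum_signs1; ring.
by rewrite lv /c; lra.
Qed.

End Rademacher.

(** * The max-norm *)

Section MaxNorm.
Variables m1 m2 : nat.
Implicit Types X : 'M[RR]_(m1, m2).

Lemma norm2inf_ge0 m k (U : 'M[RR]_(m, k)) : 0 <= norm2inf U.
Proof. exact: bigmax_ge_id. Qed.

Lemma sum_row_le_norm2inf m k (U : 'M[RR]_(m, k)) i : \sum_l U i l ^+ 2 <= norm2inf U ^+ 2.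
Proof.
have s0 : 0 <= \sum_l U i l ^+ 2 by apply: sumr_ge0 => l _; exact: sqr_ge0.
rewrite -[leLHS]sqr_sqrtr // lerXn2r ?nnegrE ?sqrtr_ge0 ?norm2inf_ge0 //.
exact: (le_bigmax (0 : RR) (fun i => Num.sqrt (\sum_l U i l ^+ 2))).
Qed.

Lemma norm2inf_le m k (U : 'M[RR]_(m, k)) a : 0 <= a ->
  (forall i, \sum_l U i l ^+ 2 <= a ^+ 2) -> norm2inf U <= a.
Proof.
move=> a0 Ua; apply: bigmax_le => // i _.
by rewrite -[a]ger0_norm // -sqrtr_sqr ler_wsqrtr.
Qed.

Lemma maxnorm_le X k (U : 'M[RR]_(m1, k)) (V : 'M[RR]_(m2, k)) a b :
  X = U *m V^T -> 0 <= a -> 0 <= b ->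
  (forall i, \sum_l U i l ^+ 2 <= a ^+ 2) -> (forall j, \sum_l V j l ^+ 2 <= b ^+ 2) ->
  maxnorm X <= a * b.
Proof.
move=> XE a0 b0 Ua Vb; apply: (@le_trans _ _ (norm2inf U * norm2inf V)).
  apply: ge_inf; last by exists k, U, V.
  by exists 0 => _ [k' [U' [V' [_ ->]]]]; rewrite mulr_ge0 ?norm2inf_ge0.
by apply: ler_pM; rewrite ?norm2inf_ge0 // norm2inf_le.
Qed.

Lemma maxnorm_factor X (rho e : RR) : maxnorm X <= rho -> 0 < e ->
  exists (k : nat) (U : 'M[RR]_(m1, k)) (V : 'M[RR]_(m2, k)),
  X = U *m V^T /\ norm2inf U * norm2inf V < rho + e.
Proof.
move=> Xr e0; set A := [set t : RR | exists (k : nat) (U : 'M[RR]_(m1, k)) (V : 'M[RR]_(m2, k)),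
         X = U *m V^T /\ t = norm2inf U * norm2inf V]%classic.
have [||t [k [U [V [XE tE]]]] tlt] := @inf_lt _ A (rho + e).
- by exists (norm2inf X * norm2inf (1%:M : 'M[RR]_m2)), m2, X, 1%:M; rewrite trmx1 mulmx1.
- by rewrite -/(maxnorm X); apply: le_lt_trans Xr _; rewrite ltrDl.
by exists k, U, V; split=> //; rewrite -tE.
Qed.

Lemma normr_le_supnorm X i j : `|X i j| <= supnorm X.
Proof.
apply: le_trans (le_bigmax (0 : RR) (fun i => \big[Num.max/0]_(j < m2) `|X i j|) i).
exact: (le_bigmax (0 : RR) (fun j => `|X i j|)).
Qed.

(* John's factorization: only approximate because maxnorm is an infimum. *)
Lemma maxnorm_le_sqrt_rank X (g : RR) : 0 <= g -> supnorm X <= g ->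
  maxnorm X <= g * Num.sqrt (\rank X)%:R.
Proof.
move=> g0 Xg; case: (posnP (\rank X)) => [r0|r0].
  rewrite r0 sqrtr0 mulr0 -(mulr0 0).
  have -> : X = 0 by apply/eqP; rewrite -mxrank_eq0 r0.
  apply: (@maxnorm_le _ 0 (0 : 'M[RR]_(m1, 0)) (0 : 'M[RR]_(m2, 0))); rewrite ?mul0mx //.
    by move=> i; rewrite big_ord0 expr0n.
  by move=> i; rewrite big_ord0 expr0n.
set r := (\rank X)%:R : RR; have rge0 : 0 <= r by rewrite /r.
apply/ler_addgt0Pr => e e0.
(* Then [sqrt (r + d) <= sqrt r + e / (g + 1)], and multiplying by [g] costs at most [e]; the [+ 1]
   covers [g = 0]. *)
pose d := Num.min 1 ((e / (g + 1)) ^+ 2).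
have eg0 : 0 < e / (g + 1) by rewrite divr_gt0 //; lra.
have d0 : 0 < d by rewrite lt_min ltr01 exprn_gt0.
have d1 : d <= 1 by rewrite ge_min lexx.
have d2 : d <= (e / (g + 1)) ^+ 2 by rewrite ge_min lexx orbT.
have Xe i j : `|X i j| <= g by exact: le_trans (normr_le_supnorm _ _ _) Xg.
have d01 : 0 < d <= 1 by rewrite d0.
have [U [V [XE Ur Vg]]] := balanced_factorization r0 Xe d01.
have rd0 : 0 <= r + d by rewrite addr_ge0 // ltW.
have Mle : maxnorm X <= Num.sqrt (r + d) * g.
  by apply: (maxnorm_le XE) => // i; rewrite sqr_sqrtr.
have sD : Num.sqrt (r + d) <= Num.sqrt r + e / (g + 1).
  have s0 := sqrtr_ge0 r.
  rewrite -[leRHS]ger0_norm ?addr_ge0 ?(ltW eg0) // -sqrtr_sqr ler_wsqrtr //.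
  rewrite sqrrD sqr_sqrtr //.
  have : 0 <= Num.sqrt r * (e / (g + 1)) by rewrite mulr_ge0 // ltW.
  lra.
apply: le_trans Mle _; apply: le_trans (ler_wpM2r g0 sD) _.
have : e / (g + 1) * g <= e by rewrite -mulrA ler_piMr ?(ltW e0) // mulrC ler_pdivrMr; lra.
by rewrite mulrDl; lra.
Qed.

(** For [X = U V^T] the pairing with [M] is the sum of the bilinear forms on the columns of [U] and
    [V], so Grothendieck's inequality applies after rescaling. A factor of norm 0 cannot be
    rescaled, but then the pairing vanishes. *)
Lemma dual_maxnorm_le (M : 'I_m1 -> 'I_m2 -> RR) X (W rho : RR) :
  (forall (s : 'I_m1 -> bool) (t : 'I_m2 -> bool),
     bilin M (fun i => (-1) ^+ s i) (fun j => (-1) ^+ t j) <= W) ->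
  maxnorm X <= rho -> \sum_i \sum_j M i j * X i j <= 8 * W * rho.
Proof.
move=> HW Xr; have HG := grothendieck HW.
have W0 : 0 <= 8 * W.
  rewrite -[0](big_ord0 _ +%R xpredT (fun=> bilin M (fun=> 0) (fun=> 0))).
  by apply: (HG 0%N (fun _ _ => 0) (fun _ _ => 0)) => i; rewrite big_ord0.
suff H e : 0 < e -> \sum_i \sum_j M i j * X i j <= 8 * W * (rho + e).
  apply/ler_addgt0Pr => e e0.
  have W1 : 0 < 8 * W + 1 by lra.
  have h := H (e / (8 * W + 1)) (divr_gt0 e0 W1); apply: le_trans h _.
  rewrite mulrDr lerD2l mulrCA ler_piMr ?(ltW e0) // ler_pdivrMr //; lra.
move=> e0; have [k [U [V [XE UV]]]] := maxnorm_factor Xr e0.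
have -> : \sum_i \sum_j M i j * X i j = \sum_l bilin M (U^~ l) (V^~ l).
  rewrite /bilin [RHS]exchange_big /=; apply: eq_bigr => i _.
  rewrite [RHS]exchange_big /=; apply: eq_bigr => j _; rewrite -mulr_sumr; congr (_ * _).
  by rewrite XE mxE; apply: eq_bigr => l _; rewrite mxE.
have z0 m (Y : 'M[RR]_(m, k)) : ~~ (0 < norm2inf Y) -> forall i l, Y i l = 0.
  move=> Y0 i l; have nY : norm2inf Y = 0.
    by apply/eqP; rewrite eq_le norm2inf_ge0 andbT leNgt.
  have := sum_row_le_norm2inf Y i; rewrite nY expr0n /= => h.
  apply/eqP; rewrite -sqrf_eq0 eq_le sqr_ge0 andbT; apply: le_trans h.
  by rewrite (bigD1 l) //= lerDl; apply: sumr_ge0 => ? _; exact: sqr_ge0.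
have re0 : 0 < rho + e by apply: le_lt_trans UV; rewrite mulr_ge0 ?norm2inf_ge0.
have [U0|U0] := boolP (0 < norm2inf U); last first.
  rewrite big1 ?(mulr_ge0 W0 (ltW re0)) // => l _.
  by apply: big1 => i _; apply: big1 => j _; rewrite z0 // mul0r mulr0.
have [V0|V0] := boolP (0 < norm2inf V); last first.
  rewrite big1 ?(mulr_ge0 W0 (ltW re0)) // => l _.
  by apply: big1 => i _; apply: big1 => j _; rewrite (z0 _ V) // mulr0 mulr0.
apply: le_trans (inner_bound_scaled HG U0 V0 _ _) _; try exact: sum_row_le_norm2inf.
by rewrite ler_wpM2l // ltW.
Qed.

Lemma radmax_maxnorm_le n (T : finType) (t0 : T) (X : T -> 'M[RR]_(m1, m2))
    (w : 'I_n -> 'I_m1 * 'I_m2) (rho : RR) :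
  (0 < m1)%N -> (forall t, maxnorm (X t) <= rho) -> 0 <= rho ->
  2 ^- n * \sum_e radmax t0 (fun i t => X t (w i).1 (w i).2) e <=
  24 * rho * Num.sqrt ((m1 + m2)%:R * n%:R).
Proof.
move=> m10 Xr rho0.
pose K := ({ffun 'I_m1 -> bool} * {ffun 'I_m2 -> bool})%type.
pose k0 : K := ([ffun=> false], [ffun=> false]).
pose s (k : K) i := k.1 (w i).1 (+) k.2 (w i).2.
pose mx (e : {ffun 'I_n -> bool}) : RR :=
  maxF k0 (fun k => \sum_i (-1) ^+ e i * (-1) ^+ s k i).
have Hm : 2 ^- n * \sum_e mx e <= 3 * Num.sqrt ((m1 + m2)%:R * n%:R).
  apply: massart; first by rewrite ltr0n addn_gt0 m10.
  rewrite card_prod !card_ffun !card_ord card_bool -expnD natrX.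
  rewrite -[X in expR X]mul1r expRM_natr lerXn2r ?nnegrE ?expR_ge0 //.
  by have := expR_ge1Dx (1 : RR); lra.
have He e : radmax t0 (fun i t => X t (w i).1 (w i).2) e <= 8 * mx e * rho.
  apply: maxF_le => t.
  (* Signed counts of the observed positions turn the Rademacher sum into a pairing with [X t], and
     a rank-one sign matrix into an element of the class [K]. *)
  pose M a b : RR := \sum_i (-1) ^+ e i * (w i == (a, b))%:R.
  have ME (F : 'I_m1 -> 'I_m2 -> RR) :
      \sum_a \sum_b M a b * F a b = \sum_i (-1) ^+ e i * F (w i).1 (w i).2.
    rewrite pair_bigA /=; under eq_bigr do rewrite mulr_suml.
    rewrite exchange_big /=; apply: eq_bigr => i _.
    rewrite (bigD1 (w i)) //= -surjective_pairing eqxx mulr1 big1 ?addr0 //.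
    by move=> [a b] /negbTE; rewrite eq_sym => -> /=; rewrite mulr0 mul0r.
  rewrite -ME; apply: dual_maxnorm_le => // s1 s2.
  rewrite /bilin (ME (fun a b => (-1) ^+ s1 a * (-1) ^+ s2 b)).
  apply: le_trans (maxF_ge k0 _ ([ffun a => s1 a], [ffun b => s2 b])) => /=.
  rewrite le_eqVlt; apply/orP; left; apply/eqP; apply: eq_bigr => i _.
  by rewrite /s /= !ffunE signr_addb.
have : 2 ^- n * \sum_e radmax t0 (fun i t => X t (w i).1 (w i).2) e <=
    8 * rho * (2 ^- n * \sum_e mx e).
  rewrite mulrCA; apply: ler_wpM2l; first by rewrite invr_ge0 exprn_ge0.
  by rewrite mulr_sumr; apply: ler_sum => e _; have := He e; lra.
move=> h; apply: le_trans h _.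
apply: le_trans (ler_wpM2l _ Hm) _; first by rewrite mulr_ge0.
by rewrite mulrA; lra.
Qed.

End MaxNorm.

(** * Logistic loss and excess risk *)

Section Logistic.
Variable R : realType.
Implicit Types x y p q : R.

(** The function [logistic] over an arbitrary [realType]. *)
Definition sigmoid x : R := expR x / (1 + expR x).

Lemma add1_expR_gt0 x : 0 < 1 + expR x.
Proof. by rewrite addr_gt0 ?expR_gt0. Qed.

Lemma sigmoid_gt0_lt1 x : 0 < sigmoid x < 1.
Proof.
rewrite divr_gt0 ?expR_gt0 ?add1_expR_gt0 //=.
by rewrite ltr_pdivrMr ?add1_expR_gt0 // mul1r ltrDr.
Qed.

Lemma half_le_sigmoid x : (1 / 2 <= sigmoid x) = (0 <= x).
Proof.
rewrite /sigmoid ler_pdivlMr ?add1_expR_gt0 // -[in RHS]ler_expR exp.expR0.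
by apply/idP/idP; lra.
Qed.

Definition loss (b : bool) x : R := - (if b then ln (sigmoid x) else ln (1 - sigmoid x)).

Lemma ln_le_sub1 x : 0 < x -> ln x <= x - 1.
Proof. by move=> x0; have := expR_ge1Dx (ln x); rewrite lnK ?posrE //; lra. Qed.

(** The loss is [ln (1 + expR z)], whose slope lies in [0, 1], minus [z] when [b] is true. *)
Lemma loss_lipschitz b x y : `|loss b x - loss b y| <= `|x - y|.
Proof.
have pos := add1_expR_gt0.
have lossE z : loss b z = ln (1 + expR z) - (if b then z else 0).
  rewrite /loss /sigmoid; case: b.
    by rewrite ln_div ?posrE ?expR_gt0 // expRK; lra.
  have -> : 1 - expR z / (1 + expR z) = (1 + expR z)^-1.
    by field; rewrite gt_eqF.
  by rewrite lnV ?posrE // opprK subr0.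
have mono (u v : R) : u <= v -> 0 <= ln (1 + expR v) - ln (1 + expR u) <= v - u.
  move=> uv; apply/andP; split; first by rewrite subr_ge0 ler_ln ?posrE // lerD2l ler_expR.
  rewrite -[v - u]expRK -ln_div ?posrE // ler_ln ?posrE ?divr_gt0 ?expR_gt0 //.
  rewrite ler_pdivrMr // mulrDr mulr1 -exp.expRD subrK lerD2r.
  by rewrite -exp.expR0 ler_expR subr_ge0.
wlog xy : x y / x <= y.
  by move=> H; case: (leP x y) => [/H//|/ltW/H]; rewrite distrC [X in _ <= X]distrC.
have /andP[h1 h2] := mono _ _ xy.
rewrite !lossE [leRHS]distrC [leRHS]ger0_norm ?subr_ge0 // ler_norml.
by case: b {lossE}; apply/andP; split; lra.
Qed.

(** With [p = a^2] and [q = b^2], [ln (b / a) <= b / a - 1] gives the lower bound [2 a^2 - 2 a b].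
    The terms [p - q] cancel when both outcomes are added. *)
Lemma kl_term_ge p q : 0 < p -> 0 < q ->
  (Num.sqrt p - Num.sqrt q) ^+ 2 + p - q <= p * (ln p - ln q).
Proof.
move=> p0 q0.
have [a a0 pE] : exists2 a : R, 0 < a & p = a ^+ 2.
  by exists (Num.sqrt p); rewrite ?sqrtr_gt0 ?sqr_sqrtr // ltW.
have [b b0 qE] : exists2 b : R, 0 < b & q = b ^+ 2.
  by exists (Num.sqrt q); rewrite ?sqrtr_gt0 ?sqr_sqrtr // ltW.
rewrite pE qE !sqrtr_sqr !ger0_norm ?(ltW a0) ?(ltW b0) // !lnXn //.
have := ln_le_sub1 (divr_gt0 b0 a0); rewrite ln_div ?posrE // => h.
have h2 : a ^+ 2 * (ln b - ln a) <= a ^+ 2 * (b / a - 1) by rewrite ler_wpM2l // sqr_ge0.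
have h3 : a ^+ 2 * (b / a - 1) = a * b - a ^+ 2 by field; rewrite gt_eqF.
by rewrite h3 in h2; rewrite !mulr2n; lra.
Qed.

(* Pinsker's inequality up to a constant, through the Hellinger distance. *)
Lemma kl_ge p q : 0 < p < 1 -> 0 < q < 1 ->
  (p - q) ^+ 2 <= 2 * (p * (ln p - ln q) + (1 - p) * (ln (1 - p) - ln (1 - q))).
Proof.
have sq x y : 0 < x < 1 -> 0 < y < 1 -> (x - y) ^+ 2 <= 4 * (Num.sqrt x - Num.sqrt y) ^+ 2.
  move=> /andP[x0 x1] /andP[y0 y1].
  have xE := sqr_sqrtr (ltW x0); have yE := sqr_sqrtr (ltW y0).
  have sx : Num.sqrt x <= 1 by rewrite -sqrtr1 ler_wsqrtr // ltW.
  have sy : Num.sqrt y <= 1 by rewrite -sqrtr1 ler_wsqrtr // ltW.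
  have := sqrtr_ge0 x; have := sqrtr_ge0 y => sy0 sx0.
  rewrite -{1}xE -{1}yE subr_sqr exprMn mulrC ler_wpM2r ?sqr_ge0 //.
  by rewrite (_ : 4 = 2 ^+ 2); [rewrite lerXn2r ?nnegrE; lra|ring].
move=> p01 q01.
have p01' : 0 < 1 - p < 1 by move/andP: p01 => [? ?]; apply/andP; split; lra.
have q01' : 0 < 1 - q < 1 by move/andP: q01 => [? ?]; apply/andP; split; lra.
have s1 := sq p q p01 q01; have := sq (1 - p) (1 - q) p01' q01'.
rewrite (_ : 1 - p - (1 - q) = q - p) => [s2|]; last by ring.
move/andP: p01 => [p0 p1]; move/andP: q01 => [q0 q1].
move/andP: p01' => [p0' p1']; move/andP: q01' => [q0' q1'].
have := kl_term_ge p0 q0; have := kl_term_ge p0' q0'.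
by move: s1 s2; rewrite ![_ ^+ 2]expr2; lra.
Qed.

End Logistic.

(** The variance is nonnegative. *)
Lemma sqr_mean_le (R : realDomainType) (S : finType) (w x : S -> R) :
  (forall s, 0 <= w s) -> \sum_s w s = 1 ->
  (\sum_s w s * x s) ^+ 2 <= \sum_s w s * x s ^+ 2.
Proof.
move=> w0 w1.
have E (m : R) : \sum_s w s * (x s - m) ^+ 2 =
    \sum_s w s * x s ^+ 2 - 2 * m * (\sum_s w s * x s) + m ^+ 2 * \sum_s w s.
  by rewrite !mulr_sumr -sumrB -big_split /=; apply: eq_bigr => s _; ring.
have : 0 <= \sum_s w s * (x s - \sum_s w s * x s) ^+ 2.
  by apply: sumr_ge0 => s _; rewrite mulr_ge0 ?sqr_ge0.
by rewrite E w1 expr2; lra.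
Qed.

(** * Risk bounds for the plug-in classifier *)

Section ExcessRisk.
Variables (m1 m2 n : nat) (Xs : 'M[RR]_(m1, m2)).
Hypotheses (m1_gt0 : (0 < m1)%N) (m2_gt0 : (0 < m2)%N) (n_gt0 : (0 < n)%N).
Local Notation obs := (bool * ('I_m1 * 'I_m2))%type.

Definition obs_prob (z : obs) : RR :=
  (m1 * m2)%:R^-1 * (if z.1 then logistic (Xs z.2.1 z.2.2) else 1 - logistic (Xs z.2.1 z.2.2)).

Definition rel_loss (X : 'M[RR]_(m1, m2)) (z : obs) : RR :=
  loss z.1 (X z.2.1 z.2.2) - loss z.1 (Xs z.2.1 z.2.2).

Definition rel_risk (X : 'M[RR]_(m1, m2)) : RR := \sum_z obs_prob z * rel_loss X z.

Lemma logisticP x : 0 < logistic x < 1.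
Proof. exact: sigmoid_gt0_lt1. Qed.

Lemma obs_prob_ge0 z : 0 <= obs_prob z.
Proof.
have /andP[p0 p1] := logisticP (Xs z.2.1 z.2.2).
by rewrite mulr_ge0 ?invr_ge0 //; case: z.1; lra.
Qed.

Lemma sum_obs (F : obs -> RR) :
  \sum_z F z = \sum_i \sum_j (F (true, (i, j)) + F (false, (i, j))).
Proof.
transitivity (\sum_(b : bool) \sum_(ij : 'I_m1 * 'I_m2) F (b, ij)).
  by rewrite pair_bigA /=; apply: eq_bigr => -[].
rewrite big_bool -big_split /= pair_bigA /=.
by apply: eq_bigr => -[].
Qed.

Lemma sum_uniform : \sum_(i < m1) \sum_(j < m2) (m1 * m2)%:R^-1 = 1 :> RR.
Proof.
under eq_bigr do rewrite sumr_const card_ord.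
rewrite sumr_const card_ord -mulrnA mulnC -[_ *+ _]mulr_natl divff //.
by rewrite pnatr_eq0 -lt0n muln_gt0 m1_gt0 m2_gt0.
Qed.

Lemma sum_obs_prob : \sum_z obs_prob z = 1.
Proof.
rewrite sum_obs -sum_uniform; apply: eq_bigr => i _; apply: eq_bigr => j _.
by rewrite /obs_prob /=; ring.
Qed.

(** At one position the classifiers differ only if 1/2 separates [p] from [q], and then the error
    gap [|1 - 2 p|] is at most [2 |p - q|]. Squaring and [kl_ge] give [4 * 2 = 8]. *)
Lemma risk_gap_sqr_le (X : 'M[RR]_(m1, m2)) :
  (risk Xs (plugin_classifier X) - risk Xs (bayes_classifier Xs)) ^+ 2 <= 8 * rel_risk X.
Proof.
pose err (x xs : RR) : RR := if sgn x then 1 - logistic xs else logistic xs.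
pose N : RR := (m1 * m2)%:R^-1.
have N0 : 0 <= N by rewrite invr_ge0.
have -> : risk Xs (plugin_classifier X) - risk Xs (bayes_classifier Xs) =
    \sum_(ij : 'I_m1 * 'I_m2) N * (err (X ij.1 ij.2) (Xs ij.1 ij.2) - err (Xs ij.1 ij.2) (Xs ij.1 ij.2)).
  rewrite /risk -sumrB -(pair_bigA _ (fun i j => N * (err (X i j) (Xs i j) - err (Xs i j) (Xs i j)))) /=.
  by apply: eq_bigr => i _; rewrite -sumrB; apply: eq_bigr => j _; rewrite mulrBr.
apply: le_trans (sqr_mean_le _ _ _) _ => [//||].
  by rewrite -(pair_bigA _ (fun _ _ => N)) /= sum_uniform.
rewrite /rel_risk sum_obs pair_bigA /= mulr_sumr; apply: ler_sum => -[i j] _ /=.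
rewrite /obs_prob /rel_loss /=.
move: (X i j) (Xs i j) => x xs.
suff : (err x xs - err xs xs) ^+ 2 <= 8 *
    (logistic xs * (loss true x - loss true xs) +
     (1 - logistic xs) * (loss false x - loss false xs)).
  by move=> /(ler_wpM2l N0) h; apply: le_trans h _; rewrite -/N le_eqVlt; apply/orP; left; apply/eqP; ring.
have := kl_ge (logisticP xs) (logisticP x).
have -> : ln (logistic xs) = - loss true xs by rewrite /loss opprK.
have -> : ln (logistic x) = - loss true x by rewrite /loss opprK.
have -> : ln (1 - logistic xs) = - loss false xs by rewrite /loss opprK.
have -> : ln (1 - logistic x) = - loss false x by rewrite /loss opprK.
have hx : sgn x = (1 / 2 <= logistic x) by rewrite [RHS]half_le_sigmoid.
have hxs : sgn xs = (1 / 2 <= logistic xs) by rewrite [RHS]half_le_sigmoid.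
rewrite /err hx hxs; move: (logistic x) (logistic xs) => q p.
move: (loss true x) (loss true xs) (loss false x) (loss false xs) => a b c d h.
suff : ((if 1 / 2 <= q then 1 - p else p) - (if 1 / 2 <= p then 1 - p else p)) ^+ 2
   <= 4 * (p - q) ^+ 2 by lra.
have := sqr_ge0 (p - q).
by case: (leP (1 / 2) q) => hq; case: (leP (1 / 2) p) => hp; nra.
Qed.

(** The empirical relative loss of the estimator is nonpositive, so [n] times its relative risk is
    at most the centred process at [Xhat S]. Samples themselves index that process. The constant is
    2 from symmetrization times 24. *)
Lemma expected_rel_risk_le (Xhat : sample m1 m2 n -> 'M[RR]_(m1, m2)) (rho : RR) :
  0 <= rho -> (forall S, maxnorm (Xhat S) <= rho) ->
  (forall S, loglik S Xs <= loglik S (Xhat S)) ->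
  \sum_S sample_prob Xs S * rel_risk (Xhat S) <=
  48 * rho * (Num.sqrt ((m1 + m2)%:R * n%:R) / n%:R).
Proof.
move=> rho0 Xr Xmle.
pose t0 : sample m1 m2 n := [ffun=> (true, (Ordinal m1_gt0, Ordinal m2_gt0))].
have n0 : 0 < n%:R :> RR by rewrite ltr0n.
rewrite mulrA ler_pdivlMr // mulr_suml.
have H1 S : rel_risk (Xhat S) * n%:R <=
    maxF t0 (fun t => \sum_(i < n) ((\sum_z obs_prob z * rel_loss (Xhat t) z) - rel_loss (Xhat t) (S i))).
  apply: le_trans (maxF_ge t0 _ S); rewrite sumrB sumr_const card_ord -/(rel_risk _) mulr_natr.
  rewrite lerDl oppr_ge0 /rel_loss sumrB subr_le0.
  have LE X : loglik S X = \sum_i - loss (S i).1 (X (S i).2.1 (S i).2.2).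
    by apply: eq_bigr => i _; rewrite /loss opprK.
  by rewrite -lerN2 -!sumrN -!LE.
apply: (@le_trans _ _ (\sum_S prodp obs_prob S *
    maxF t0 (fun t => \sum_(i < n) ((\sum_z obs_prob z * rel_loss (Xhat t) z) - rel_loss (Xhat t) (S i))))).
  apply: ler_sum => S _; rewrite -mulrA.
  by apply: (ler_wpM2l (prodp_ge0 obs_prob_ge0 S)); exact: H1.
apply: le_trans (symmetrization n t0 (fun t => rel_loss (Xhat t))
  obs_prob_ge0 sum_obs_prob) _.
have -> : 48 * rho * Num.sqrt ((m1 + m2)%:R * n%:R) =
    2 * \sum_(S : sample m1 m2 n) prodp obs_prob S * (24 * rho * Num.sqrt ((m1 + m2)%:R * n%:R)).
  by rewrite -mulr_suml (sum_prodp _ sum_obs_prob); ring.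
rewrite ler_wpM2l //; apply: ler_sum => S _; rewrite ler_wpM2l //.
  by apply: prodp_ge0; exact: obs_prob_ge0.
apply: le_trans (radmax_maxnorm_le t0 (fun i => (S i).2) m1_gt0 Xr rho0).
rewrite ler_wpM2l ?invr_ge0 ?exprn_ge0 //; apply: contraction => i t s.
rewrite /rel_loss (_ : _ - _ - _ = loss (S i).1 (Xhat t (S i).2.1 (S i).2.2) -
  loss (S i).1 (Xhat s (S i).2.1 (S i).2.2)); last by ring.
exact: loss_lipschitz.
Qed.

End ExcessRisk.

Theorem theorem1 :
  forall gamma : RR, 0 < gamma ->
  exists C : RR, 0 < C /\
  forall (m1 m2 n : nat), (0 < m1)%N -> (0 < m2)%N -> (0 < n)%N ->
  forall Xs : 'M[RR]_(m1, m2), supnorm Xs <= gamma ->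
  forall Xhat : sample m1 m2 n -> 'M[RR]_(m1, m2),
    (forall S : sample m1 m2 n, Kmax gamma (\rank Xs)%:R (Xhat S) /\
       (forall X : 'M[RR]_(m1, m2), Kmax gamma (\rank Xs)%:R X -> loglik S X <= loglik S (Xhat S))) ->
    excess Xs Xhat <=
      Num.sqrt (C * Num.sqrt ((\rank Xs)%:R * (m1 + m2)%:R / n%:R)).
Proof.
(* Here 384 is [8 * 48], from [risk_gap_sqr_le] and [expected_rel_risk_le]; [g] comes from the
   max-norm radius [g * sqrt r]. *)
move=> g g0; exists (384 * g); split; first by rewrite mulr_gt0.
move=> m1 m2 n m10 m20 n0 Xs Xsg Xhat Hhat.
set r : RR := (\rank Xs)%:R; set d : RR := (m1 + m2)%:R.
have nn : 0 < n%:R :> RR by rewrite ltr0n.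
have XsK : Kmax g r Xs by split=> //; apply: maxnorm_le_sqrt_rank => //; exact: ltW.
pose gap S := risk Xs (plugin_classifier (Xhat S)) - risk Xs (bayes_classifier Xs).
have p0 (S : sample m1 m2 n) : 0 <= sample_prob Xs S.
  exact: (prodp_ge0 (obs_prob_ge0 Xs) S).
have p1 : \sum_(S : sample m1 m2 n) sample_prob Xs S = 1.
  exact: (sum_prodp n (sum_obs_prob Xs m10 m20)).
have E : excess Xs Xhat = \sum_S sample_prob Xs S * gap S.
  transitivity (\sum_S sample_prob Xs S * risk Xs (plugin_classifier (Xhat S)) -
    1 * risk Xs (bayes_classifier Xs)); first by rewrite mul1r.
  rewrite -p1 mulr_suml -sumrB.
  by apply: eq_bigr => S _; rewrite mulrBr.
apply: le_trans (ler_norm _) _; rewrite -sqrtr_sqr ler_wsqrtr // E.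
apply: le_trans (sqr_mean_le gap p0 p1) _.
have H := @expected_rel_risk_le m1 m2 n Xs m10 m20 n0 Xhat (g * Num.sqrt r)
  (mulr_ge0 (ltW g0) (sqrtr_ge0 _)) (fun S => (Hhat S).1.2) (fun S => (Hhat S).2 Xs XsK).
apply: (@le_trans _ _ (8 * \sum_S sample_prob Xs S * rel_risk Xs (Xhat S))).
  rewrite mulr_sumr; apply: ler_sum => S _.
  by rewrite [leRHS]mulrCA ler_wpM2l // risk_gap_sqr_le.
have -> : Num.sqrt (r * d / n%:R) = Num.sqrt r * (Num.sqrt (d * n%:R) / n%:R).
  have -> : r * d / n%:R = r * (d * n%:R) * (n%:R^-1) ^+ 2 by field; rewrite gt_eqF.
  rewrite sqrtrM ?mulr_ge0 // sqrtrM // sqrtr_sqr ger0_norm ?invr_ge0 // -mulrA //.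
by move: H; rewrite -/d; lra.
Qed.
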